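(* Let $F:Q=[0,1]^3\to\mathbb R^3$ be a trilinear map with Jacobian determinant $J=\det(DF)$, and let $\mathcal C_{\partial Q}\subset\partial Q$ be the finite set of boundary candidate points defined in the context. Then $\min_{p\in\mathcal C_{\partial Q}}J(p)=\min_{p\in\partial Q}J(p)$, and the hexahedron $F(Q)$ is valid (i.e. $J(p)>0$ for all $p\in Q$) if and only if $J(p)>0$ for every $p\in\mathcal C_{\partial Q}$. Moreover, if $\min_{p\in\mathcal C_{\partial Q}}J(p)>0$, then this value equals $\min_{p\in Q}J(p)$.
   Context: A map $F:Q\to\mathbb R^3$ is trilinear if it is affine in each of the coordinates $x,y,z$ separately. $DF=[\partial F/\partial x\mid\partial F/\partial y\mid\partial F/\partial z]$ and $J=\det(DF)$, a polynomial. Face restriction. On a face $x=x_0$ with $x_0\in\{0,1\}$ put $f(s,t)=J(x_0,s,t)$ for $(s,t)\in K=[0,1]^2$; on faces $y=y_0$ and $z=z_0$ (with $y_0,z_0\in\{0,1\}$) put $f(s,t)=J(s,y_0,t)$ and $f(s,t)=J(s,t,z_0)$ respectively. Every such $f$ has the form $$f(s,t)=a(t)s^2+b(t)s+c(t),\quad a(t)=a_0+a_1t,\quad b(t)=b_0+b_1t+b_2t^2,\quad c(t)=c_0+c_1t+c_2t^2,$$ with eight real coefficients determined by $F$ and the face. Put $$P(t)=4a(t)^2c'(t)-2a(t)b(t)b'(t)+a'(t)b(t)^2,$$ a polynomial of degree at most four. Candidates of a face. Perimeter candidates: the four corners of $K$, together with, for each of the four edges of $K$ parametrized by $r\in[0,1]$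 as $(0,r)$, $(1,r)$, $(r,0)$, $(r,1)$, on which $f$ restricts to a polynomial $d_2r^2+d_1r+d_0$, the point of the edge with parameter $r_*=-d_1/(2d_2)$ whenever $d_2>0$ and $0<r_*<1$. Interior candidates: if $P$ is not the zero polynomial, all points $(s_*(t),t)$ where $t\in(0,1)$ is a real root of $P$ with $a(t)>0$ and $s_*(t)=-b(t)/(2a(t))$ satisfies $0<s_*(t)<1$. If $P$ is identically zero there are no interior candidates. $\mathcal C_{\partial Q}$ is the set of all points of $\partial Q$ corresponding, under the face parametrizations $(s,t)\mapsto(x_0,s,t)$ on the faces $x=x_0$, $(s,t)\mapsto(s,y_0,t)$ on the faces $y=y_0$, and $(s,t)\mapsto(s,t,z_0)$ on the faces $z=z_0$ (with $x_0,y_0,z_0\in\{0,1\}$ and $(s,t)\in K$), to the candidates of the six faces. *)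

(* Defs.v *)
From HB Require Import structures.
From mathcomp Require Import all_boot all_order all_algebra.
From mathcomp Require Import all_classical all_reals all_analysis.

Set Implicit Arguments.
Unset Strict Implicit.
Unset Printing Implicit Defensive.

Import Order.TTheory GRing.Theory Num.Theory.
Import numFieldNormedType.Exports.

Local Open Scope classical_set_scope.
Local Open Scope ring_scope.

Section Hexahedron.
Variable R : realType.
Implicit Types (F : 'cV[R]_3 -> 'cV[R]_3) (p : 'cV[R]_3) (i : 'I_3).

Definition pt (x y z : R) : 'cV[R]_3 := \col_k [:: x; y; z]`_k.

Definition cube : set 'cV[R]_3 := [set p : 'cV[R]_3 | forall i, 0 <= p i 0 <= 1].

Definition bd_cube : set 'cV[R]_3 := closure cube `\` cube°.

Definition set_coord p i (t : R) : 'cV[R]_3 :=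
  \col_k (if k == i then t else p k 0).

(* Maps Q -> R^3 are represented by total functions; every notion below only
   looks at the values on [cube]. *)
Definition trilinear F : Prop :=
  forall p i, cube p ->
    exists u v : 'cV[R]_3,
      forall t : R, 0 <= t <= 1 -> F (set_coord p i t) = t *: u + v.

(* The difference quotient of ['D_e F p], with the increment restricted so as
   to stay in the cube: the derivative is one-sided on faces normal to e. *)
Definition partial F i p : 'cV[R]_3 :=
  let e : 'cV[R]_3 := delta_mx i 0 in
  lim ((fun h : R => h^-1 *: (F (h *: e + p) - F p))
         @ within [set h : R | cube (h *: e + p)] (0 : R)^').

Definition DF F p : 'M[R]_3 := \matrix_(k, j) partial F j p k 0.

Definition jac F p : R := \det (DF F p).

Definition valid_hex F : Prop := forall p, cube p -> 0 < jac F p.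

(* Parametrization of the face on which coordinate i equals e (0 or 1). *)
Definition face_pt i (e : bool) (s t : R) : 'cV[R]_3 :=
  match val i with
  | 0%N => pt e%:R s t
  | 1%N => pt s e%:R t
  | _ => pt s t e%:R
  end.

(* f(s,t) = a(t) s^2 + b(t) s + c(t) on the unit square, with deg a <= 1,
   deg b <= 2 and deg c <= 2; this determines a, b and c. *)
Definition face_form (f : R -> R -> R) (a b c : {poly R}) : Prop :=
  [/\ (size a <= 2)%N, (size b <= 3)%N, (size c <= 3)%N &
      forall s t : R, 0 <= s <= 1 -> 0 <= t <= 1 ->
        f s t = a.[t] * s ^+ 2 + b.[t] * s + c.[t]].

Definition face_poly (a b c : {poly R}) : {poly R} :=
  4 *: (a ^+ 2 * c^`()) - 2 *: (a * b * b^`()) + a^`() * b ^+ 2.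

(* Parameters r_* of the (at most one) interior vertex of g, where g is the
   restriction of J to an edge, i.e. a quadratic polynomial on [0,1]. *)
Definition edge_vertex (g : R -> R) : set R :=
  [set r : R | exists d2 d1 d0 : R,
    [/\ forall u : R, 0 <= u <= 1 -> g u = d2 * u ^+ 2 + d1 * u + d0,
        0 < d2, r = - d1 / (2 * d2) & 0 < r < 1]].

Definition perimeter_cand (f : R -> R -> R) : set (R * R) :=
  [set q : R * R | (q.1 = 0 \/ q.1 = 1) /\ (q.2 = 0 \/ q.2 = 1)]
  `|` [set (0, r) | r in edge_vertex (fun r => f 0 r)]
  `|` [set (1, r) | r in edge_vertex (fun r => f 1 r)]
  `|` [set (r, 0) | r in edge_vertex (fun r => f r 0)]
  `|` [set (r, 1) | r in edge_vertex (fun r => f r 1)].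

Definition interior_cand (f : R -> R -> R) : set (R * R) :=
  [set q : R * R | exists a b c : {poly R},
    [/\ face_form f a b c, face_poly a b c != 0,
        0 < q.2 < 1 /\ root (face_poly a b c) q.2,
        0 < a.[q.2] &
        q.1 = - b.[q.2] / (2 * a.[q.2]) /\ 0 < q.1 < 1]].

Definition face_cand (f : R -> R -> R) : set (R * R) :=
  perimeter_cand f `|` interior_cand f.

Definition bd_cand F : set 'cV[R]_3 :=
  [set p : 'cV[R]_3 | exists i (e : bool) (s t : R),
    face_cand (fun s' t' => jac F (face_pt i e s' t')) (s, t) /\
    p = face_pt i e s t].

(* m is the minimum of f over A, and it is attained. *)
Definition is_min (T : Type) (f : T -> R) (A : set T) (m : R) : Prop :=
  (f @` A) m /\ lbound (f @` A) m.

End Hexahedron.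

(* Main.v *)
Require Import Defs.
From mathcomp Require Import all_boot all_order all_algebra.
From mathcomp Require Import all_classical all_reals all_analysis.
From mathcomp Require Import ring lra.

(* Write X = F_x(y,z), Y = F_y(x,z), Z = F_z(x,y), so J = det(X, Y, Z).  The
   three determinants V(y) = det(X, F_xz, Z), U(z) = det(X, Y, F_xy) and
   W(x) = det(F_yz, Y, Z) each depend on a single variable, and along a line in
   the x direction J is a quadratic d2 h^2 + d1 h + J with
     d1^2 - 4 J d2 = m^2 + 4 U(z) V(y),
   and cyclically.  Two of U, V, W always have a nonnegative product.

   Suppose J > 0 on the boundary of the cube.  If V(y) = 0, the slice at height
   y is mapped into a plane, J factors there and is positive on the slice.  So
   if J <= 0 at some point, U, V, W are nonzero there, and, say, U V > 0.  In
   that horizontal slice take the point with J <= 0, U V >= 0 and least y: the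
   positive discriminant gives J < 0 nearby, so y can be lowered further, a
   contradiction.  Hence J > 0 in the cube.  At an interior minimum with, say,
   U V >= 0 we have d1 = 0 <= d2, and the identity forces d2 = 0: J is constant
   along the x-line, so the minimum is also attained on the boundary. *)

Set Implicit Arguments.
Unset Strict Implicit.

Import Order.TTheory GRing.Theory Num.Theory.
Import numFieldNormedType.Exports.

Local Open Scope classical_set_scope.
Local Open Scope ring_scope.

(** * The Jacobian of a trilinear map *)

Section TrilinearJacobian.
Variable R : realType.

Definition det3 (a b c : 'cV[R]_3) : R :=
  let: (i, j, k) := (0 : 'I_3, 1 : 'I_3, 2%:R : 'I_3) in
  a i 0 * (b j 0 * c k 0 - b k 0 * c j 0)
  - b i 0 * (a j 0 * c k 0 - a k 0 * c j 0)
  + c i 0 * (a j 0 * b k 0 - a k 0 * b j 0).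

Lemma det3_turn (a b c : 'cV[R]_3) : det3 a b c = det3 b c a.
Proof. rewrite /det3; ring. Qed.

Lemma det3_line (a b c u v : 'cV[R]_3) (h : R) :
  det3 a (b + h *: u) (c + h *: v) =
  det3 a b c + (det3 a u c + det3 a b v) * h + det3 a u v * h ^+ 2.
Proof. rewrite /det3 !mxE; ring. Qed.

(* Along a line on which [a] is constant and [b], [c] are affine, the
   discriminant of the determinant is a square plus a product of two
   determinants that are constant on that line. *)
Lemma det3_discr (a b c u v : 'cV[R]_3) :
  (det3 a u c + det3 a b v) ^+ 2 - 4 * det3 a b c * det3 a u v =
  (det3 a u c - det3 a b v) ^+ 2 + 4 * (det3 a b u * det3 a v c).
Proof. rewrite /det3; ring. Qed.

(** With n and n' the cross products of [a], [c] and of [a'], [c'], both sides are the scalar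
    product of b x b' with n x n'. If [a], [c], [a'], [c'] span at most a plane, they vanish, so [b]
    and [b'] can be exchanged. *)
Lemma det3_exchange (a c a' c' b b' : 'cV[R]_3) :
  det3 a b c * det3 a' b' c' - det3 a b' c * det3 a' b c' =
  det3 a c c' * det3 a' b b' - det3 a c a' * det3 c' b b'.
Proof. rewrite /det3; ring. Qed.

(* The map is const + x A + y B + z C + xy u + xz v + yz w + xyz q. *)
Record trilin := Trilin {
  coefA : 'cV[R]_3; coefB : 'cV[R]_3; coefC : 'cV[R]_3;
  coefu : 'cV[R]_3; coefv : 'cV[R]_3; coefw : 'cV[R]_3;
  coefq : 'cV[R]_3 }.

(* Cyclic relabelling of the coordinates: [turn T] at (y, z, x) is T at (x, y, z). *)
Definition turn (T : trilin) : trilin :=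
  let: Trilin A B C u v w q := T in Trilin B C A w u v q.

Lemma turnK (T : trilin) : turn (turn (turn T)) = T.
Proof. by case: T. Qed.

Definition dx (T : trilin) (y z : R) : 'cV[R]_3 :=
  coefA T + y *: coefu T + z *: coefv T + (y * z) *: coefq T.
Definition dy (T : trilin) (x z : R) : 'cV[R]_3 :=
  coefB T + x *: coefu T + z *: coefw T + (x * z) *: coefq T.
Definition dz (T : trilin) (x y : R) : 'cV[R]_3 :=
  coefC T + x *: coefv T + y *: coefw T + (x * y) *: coefq T.

Definition jacT (T : trilin) (x y z : R) : R :=
  det3 (dx T y z) (dy T x z) (dz T x y).

Lemma jacT_turn (T : trilin) (x y z : R) : jacT (turn T) y z x = jacT T x y z.
Proof.
case: T => A B C u v w q; rewrite /jacT /dx /dy /dz /=.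
rewrite -det3_turn; congr det3; apply/matrixP => i j; rewrite !mxE; ring.
Qed.

(* det (F_x, F_xz, F_z): it does not depend on x and z, and it vanishes when
   the slice at height y is mapped into a plane. *)
Definition twist (T : trilin) (y : R) : R :=
  det3 (dx T y 0) (coefv T + y *: coefq T) (dz T 0 y).

Lemma jacT_line (T : trilin) (x y z : R) :
  exists d1 d2 m : R,
    (forall h, jacT T (x + h) y z = jacT T x y z + d1 * h + d2 * h ^+ 2) /\
    d1 ^+ 2 - 4 * jacT T x y z * d2 = m ^+ 2 + 4 * (twist T y * twist (turn T) z).
Proof.
(* [u] and [v] are F_xy and F_xz: along the x-line [X] is fixed, while [Y] and [Z] move with these
   velocities. *)
pose X := dx T y z; pose Y := dy T x z; pose Z := dz T x y.
pose u := coefu T + z *: coefq T; pose v := coefv T + y *: coefq T.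
exists (det3 X u Z + det3 X Y v), (det3 X u v), (det3 X u Z - det3 X Y v).
split.
  move=> h; rewrite -det3_line; congr det3;
    by apply/matrixP => i j; rewrite !mxE; ring.
(* [X] changes with y, and [Y] with x, by multiples of [u], so this determinant depends on z
   alone. *)
have -> : twist (turn T) z = det3 X Y u.
  rewrite /twist /X /Y /u; case: T {X Y Z u v} => A B C u v w q.
  rewrite /dx /dy /dz /det3 /= !mxE; ring.
have -> : twist T y = det3 X v Z.
  rewrite /twist /X /Z /v /dx /dz /det3 !mxE; ring.
rewrite -[jacT T x y z]/(det3 X Y Z) det3_discr; ring.
Qed.

Definition unit_itv (x : R) : bool := (0 <= x <= 1).

Lemma unit0 : unit_itv 0. Proof. by rewrite /unit_itv lexx ler01. Qed.
Lemma unit1 : unit_itv 1. Proof. by rewrite /unit_itv lexx ler01. Qed.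

(** On each edge [g] is affine without zeros, so positivity passes from corner to corner; inside,
    [g] is a convex combination of the corner values. *)
Lemma bilinear_pos (g : R -> R -> R) :
  (forall x z, g x z = (1 - x) * (1 - z) * g 0 0 + x * (1 - z) * g 1 0
                       + (1 - x) * z * g 0 1 + x * z * g 1 1) ->
  (forall x z, unit_itv x -> unit_itv z ->
     [|| x == 0, x == 1, z == 0 | z == 1] -> g x z != 0) ->
  0 < g 0 0 -> forall x z, unit_itv x -> unit_itv z -> 0 < g x z.
Proof.
move=> gE gN0 g00.
have u0 := unit0.
have u1 := unit1.
have aff (a b : R) : 0 < a -> (forall t, unit_itv t -> (1 - t) * a + t * b != 0) ->
    0 < b.
  move=> a0 N; rewrite ltNge; apply/negP => b0.
  have ab : 0 < a - b by lra.
  have /N/eqP[] : unit_itv (a / (a - b)).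
    by rewrite /unit_itv divr_ge0 ?(ltW a0) ?(ltW ab)//= ler_pdivrMr// mul1r; lra.
  by field; lra.
have g10 : 0 < g 1 0.
  apply: (aff _ _ g00) => t t01.
  have := gN0 t 0 t01 u0; rewrite eqxx !orbT => /(_ isT); rewrite gE.
  by congr (_ != 0); ring.
have g01 : 0 < g 0 1.
  apply: (aff _ _ g00) => t t01.
  have := gN0 0 t u0 t01; rewrite eqxx => /(_ isT); rewrite gE.
  by congr (_ != 0); ring.
have g11 : 0 < g 1 1.
  apply: (aff _ _ g10) => t t01.
  have := gN0 1 t u1 t01; rewrite eqxx orbT => /(_ isT); rewrite gE.
  by congr (_ != 0); ring.
move=> x z /andP[x0 x1] /andP[z0 z1]; rewrite gE.
pose m := Num.min (Num.min (g 0 0) (g 1 0)) (Num.min (g 0 1) (g 1 1)).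
have m0 : 0 < m by rewrite !lt_min g00 g10 g01 g11.
have [m1 m2 m3 m4] : [/\ m <= g 0 0, m <= g 1 0, m <= g 0 1 & m <= g 1 1].
  by rewrite /m; split; rewrite !ge_min lexx ?orbT.
have x1' : 0 <= 1 - x by lra.
have z1' : 0 <= 1 - z by lra.
have l1 := ler_wpM2l (mulr_ge0 x1' z1') m1.
have l2 := ler_wpM2l (mulr_ge0 x0 z1') m2.
have l3 := ler_wpM2l (mulr_ge0 x1' z0) m3.
have l4 := ler_wpM2l (mulr_ge0 x0 z0) m4.
apply: (lt_le_trans m0); apply: (le_trans _ (lerD (lerD (lerD l1 l2) l3) l4)).
by rewrite le_eqVlt; apply/orP; left; apply/eqP; ring.
Qed.

(* When F maps the slice into a plane, [det3 (F_x p) (F_y p') (F_z p)] is a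
   function of p times a function of p', each at most bilinear; on the boundary
   neither factor vanishes, so each keeps its sign. *)
Lemma twist0_slice_pos (T : trilin) (y : R) : twist T y = 0 ->
  (forall x z, unit_itv x -> unit_itv z ->
     [|| x == 0, x == 1, z == 0 | z == 1] -> 0 < jacT T x y z) ->
  forall x z, unit_itv x -> unit_itv z -> 0 < jacT T x y z.
Proof.
move=> tw0 bd.
pose G x z x' z' := det3 (dx T y z) (dy T x' z') (dz T x y).
have tw x z : det3 (dx T y z) (coefv T + y *: coefq T) (dz T x y) = 0.
  by rewrite -tw0 /twist /dx /dz /det3 !mxE; ring.
(* Within the slice the vectors [dx] differ by multiples of F_xz, and so do the vectors [dz]; the
   exchange error is therefore made of multiples of the twist. *)
have GG x z x' z' a b c d :
    G x z a b * G x' z' c d = G x z c d * G x' z' a b.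
  apply/eqP; rewrite -subr_eq0 /G det3_exchange.
  have -> : det3 (dx T y z) (dz T x y) (dz T x' y) =
      (x - x') * det3 (dx T y z) (coefv T + y *: coefq T) (dz T x y).
    by rewrite /dx /dz /det3 !mxE; ring.
  have -> : det3 (dx T y z) (dz T x y) (dx T y z') =
      (z - z') * det3 (dx T y z) (coefv T + y *: coefq T) (dz T x y).
    by rewrite /dx /dz /det3 !mxE; ring.
  by rewrite tw !mulr0 !mul0r subrr.
have GJ x z : G x z x z = jacT T x y z by [].
have u0 := unit0.
have G0 : 0 < G 0 0 0 0 by apply: bd => //; rewrite eqxx.
have bdG x z : unit_itv x -> unit_itv z -> [|| x == 0, x == 1, z == 0 | z == 1] ->
    (G x z 0 0 != 0) && (G 0 0 x z != 0).
  (* The product of the two factors becomes [G x z x z * G 0 0 0 0], a product of two boundary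
     values of J. *)
  move=> ux uz xz; rewrite -negb_or -mulf_eq0 -GG.
  by rewrite mulf_neq0 // gt_eqF // GJ bd.
move=> x z ux uz.
have Gp : 0 < G x z 0 0.
  apply: (@bilinear_pos (fun x z => G x z 0 0)) => //.
    by move=> s t; rewrite /G /dx /dz /det3 !mxE; ring.
  by move=> s t us ut st; case/andP: (bdG s t us ut st).
have Gq : 0 < G 0 0 x z.
  apply: (@bilinear_pos (fun x z => G 0 0 x z)) => //.
    by move=> s t; rewrite /G /dy /det3 !mxE; ring.
  by move=> s t us ut st; case/andP: (bdG s t us ut st).
by rewrite -GJ -(pmulr_lgt0 _ G0) GG mulr_gt0.
Qed.

End TrilinearJacobian.

(** * Continuity of the Jacobian and of the twists *)

Section Continuity.
Variable R : realType.

Lemma cvg_det3 (I : Type) (F : set_system I) {FF : Filter F}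
    (a b c : I -> 'cV[R]_3) (a' b' c' : 'cV[R]_3) :
  a t @[t --> F] --> a' -> b t @[t --> F] --> b' -> c t @[t --> F] --> c' ->
  det3 (a t) (b t) (c t) @[t --> F] --> det3 a' b' c'.
Proof.
move=> ca cb cc; have E (f : I -> 'cV[R]_3) (l : 'cV[R]_3) i j :
    f t @[t --> F] --> l -> f t i j @[t --> F] --> l i j.
  by move=> cf; exact: (cvg_comp _ _ cf (@coord_continuous R 3 1 i j l)).
rewrite /det3.
by apply: cvgD; first apply: cvgB; (apply: cvgM; [|apply: cvgB; apply: cvgM]);
  apply: E.
Qed.

Lemma cvg_bilinear (V : normedModType R) (I : Type) (F : set_system I) {FF : Filter F}
    (a b c d : V) (s t : I -> R) (s' t' : R) :
  s i @[i --> F] --> s' -> t i @[i --> F] --> t' ->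
  a + s i *: b + t i *: c + (s i * t i) *: d @[i --> F] -->
  a + s' *: b + t' *: c + (s' * t') *: d.
Proof.
move=> cs ct; do 3? apply: cvgD; try exact: cvg_cst.
- exact: cvgZr_tmp.
- exact: cvgZr_tmp.
- by apply: cvgZr_tmp; apply: cvgM.
Qed.

Lemma cvg_jacT (I : Type) (F : set_system I) {FF : Filter F} (T : trilin R)
    (x y z : I -> R) (x' y' z' : R) :
  x t @[t --> F] --> x' -> y t @[t --> F] --> y' -> z t @[t --> F] --> z' ->
  jacT T (x t) (y t) (z t) @[t --> F] --> jacT T x' y' z'.
Proof. by move=> cx cy cz; apply: cvg_det3; apply: cvg_bilinear. Qed.

Lemma cvg_twist (I : Type) (F : set_system I) {FF : Filter F} (T : trilin R)
    (y : I -> R) (y' : R) :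
  y t @[t --> F] --> y' -> twist T (y t) @[t --> F] --> twist T y'.
Proof.
move=> cy; apply: cvg_det3.
- by apply: cvg_bilinear => //; apply: cvg_cst.
- by apply: cvgD; [exact: cvg_cst|apply: cvgZr_tmp].
- by apply: cvg_bilinear => //; apply: cvg_cst.
Qed.

Lemma continuous_fst (U V : topologicalType) : continuous (@fst U V).
Proof. by move=> -[a b]; apply: cvg_fst. Qed.

Lemma continuous_snd (U V : topologicalType) : continuous (@snd U V).
Proof. by move=> -[a b]; apply: cvg_snd. Qed.
End Continuity.

(** * Positivity and minimum in the cube *)

Section Positivity.
Variable R : realType.
Implicit Types (T : trilin R) (x y z : R).

Definition on_bd x y z : bool :=
  [&& unit_itv x, unit_itv y, unit_itv z &
      [|| x == 0, x == 1, y == 0, y == 1, z == 0 | z == 1]].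

Lemma on_bd_turn x y z : on_bd y z x = on_bd x y z.
Proof.
rewrite /on_bd; case: (unit_itv x) (unit_itv y) (unit_itv z) => [] [] [] //=.
by case: (x == 0) (x == 1) => [] []; rewrite ?orbT ?orbF.
Qed.

Lemma compact_unit_square :
  compact ([set p : R * R | unit_itv p.1 && unit_itv p.2]).
Proof.
rewrite (_ : [set _ | _] = `[0, 1] `*` `[0, 1]); last first.
  apply/seteqP; split=> -[x y] /=; rewrite !in_itv /unit_itv /=.
    by move=> /andP[].
  by move=> [-> ->].
by apply: compact_setX; apply: segment_compact.
Qed.

(** If [j < 0], take [h = 0]. If [j = 0], then [d1 != 0], and a short step against the slope
    works. *)
Lemma quadratic_neg (j d1 d2 x : R) : 0 < x < 1 -> j <= 0 ->
  0 < d1 ^+ 2 - 4 * j * d2 ->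
  exists2 h, unit_itv (x + h) & j + d1 * h + d2 * h ^+ 2 < 0.
Proof.
move=> x01; rewrite le_eqVlt => /predU1P[-> | j0]; last first.
  by exists 0; [rewrite /unit_itv; lra|rewrite expr0n /= !mulr0 !addr0].
rewrite mulr0 mul0r subr0 => d10.
have d1N0 : d1 != 0 by move: d10; apply: contraTN => /eqP->; rewrite expr0n ltxx.
(* The bounds keep [x - e * d1] in the unit interval and [e * d2] below 1; halving makes them
   strict. *)
pose e := Num.min (Num.min (x / `|d1|) ((1 - x) / `|d1|)) (1 / (1 + `|d2|)) / 2.
have n1 : 0 < `|d1| by rewrite normr_gt0.
have n2 : 0 <= `|d2| by [].
have e0 : 0 < e.
  by rewrite divr_gt0 // !lt_min !divr_gt0 //; lra.
have [l1 l2 l3] : [/\ e < x / `|d1|, e < (1 - x) / `|d1| & e < 1 / (1 + `|d2|)].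
  have : e < e * 2 by lra.
  by rewrite {2}/e mulfVK ?pnatr_eq0 // !lt_min => /andP[/andP[]].
move: l1 l2 l3; rewrite !ltr_pdivlMr; [move=> l1 l2 l3| lra| lra|lra].
have ed : `|e * d1| = e * `|d1| by rewrite normrM (gtr0_norm e0).
have b1 : - (e * `|d1|) <= e * d1 <= e * `|d1| by rewrite -ler_norml ed.
have ed2 : e * d2 < 1.
  have := ler_wpM2l (ltW e0) (ler_norm d2); lra.
exists (- (e * d1)); first by rewrite /unit_itv; lra.
have -> : 0 + d1 * - (e * d1) + d2 * (- (e * d1)) ^+ 2 =
  - (e * d1 ^+ 2 * (1 - e * d2)) by ring.
by rewrite oppr_lt0; apply: mulr_gt0; [apply: mulr_gt0|rewrite subr_gt0].
Qed.

(** First- and second-order conditions at an interior minimum: a nonzero slope contradicts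
    [quadratic_neg] with [j = 0], and then [h = - x] gives the sign of [d2]. *)
Lemma quadratic_min (d1 d2 x : R) : 0 < x < 1 ->
  (forall h, unit_itv (x + h) -> 0 <= d1 * h + d2 * h ^+ 2) -> d1 = 0 /\ 0 <= d2.
Proof.
move=> x01 D; have d10 : d1 = 0.
  apply/eqP; apply: contraT => d1N0.
  have := @quadratic_neg 0 d1 d2 x x01 (lexx _); rewrite mulr0 mul0r subr0.
  rewrite exprn_even_gt0 //= => /(_ d1N0)[h uh].
  by rewrite add0r ltNge D.
split=> //; have /D : unit_itv (x + - x) by rewrite addrN /unit_itv lexx ler01.
by rewrite d10 mul0r add0r pmulr_lge0 // sqrrN exprn_gt0 //; lra.
Qed.

Lemma twist_neq0 T : (forall x y z, on_bd x y z -> 0 < jacT T x y z) ->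
  forall x y z, unit_itv x -> unit_itv y -> unit_itv z ->
  jacT T x y z <= 0 -> twist T y != 0.
Proof.
move=> bd x y z ux uy uz J0; apply/eqP => t0.
suff : 0 < jacT T x y z by rewrite ltNge J0.
apply: (twist0_slice_pos t0) => // x' z' ux' uz' b; apply: bd.
by rewrite /on_bd ux' uy uz' /=; case/or4P: b => ->; rewrite ?orbT.
Qed.

(** The descent in y within the slice at height z. Where J <= 0 neither twist vanishes, so their
    product, and with it the discriminant, is strictly positive. *)
Lemma twist_same_sign_pos T : (forall x y z, on_bd x y z -> 0 < jacT T x y z) ->
  forall x y z, unit_itv x -> unit_itv y -> unit_itv z ->
  0 <= twist T y * twist (turn T) z -> twist (turn T) z != 0 -> 0 < jacT T x y z.
Proof.
move=> bd x0 y0 z ux uy uz tw0 twz; rewrite ltNge; apply/negP => J0.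
pose tw y := twist T y * twist (turn T) z.
pose J (p : R * R) := jacT T p.1 p.2 z.
have cJ (F : set_system (R * R)) (FF : Filter F) p : F --> p -> J q @[q --> F] --> J p.
  move=> cF; apply: cvg_jacT; last exact: cvg_cst.
    exact: (cvg_comp _ _ cF (@continuous_fst _ _ _)).
  exact: (cvg_comp _ _ cF (@continuous_snd _ _ _)).
have ctw : continuous (fun p : R * R => tw p.2).
  move=> p; rewrite /continuous_at /tw; apply: cvgM; last exact: cvg_cst.
  by apply: (@cvg_twist _ _ _ _ T snd p.2); exact: continuous_snd.
(* Non-strict inequalities make [S] closed, so it has a point of least y. *)
pose S := [set p : R * R | unit_itv p.1 && unit_itv p.2] `&`
  ([set p | J p <= 0] `&` [set p | 0 <= tw p.2]).
have cS : compact S.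
  apply: compact_closedI; first exact: compact_unit_square.
  apply: closedI.
    apply: (@preimage_closed _ _ J [set r | r <= 0]); last exact: closed_le.
    by move=> p _; apply: cJ.
  apply: (@preimage_closed _ _ (fun p : R * R => tw p.2) [set r | 0 <= r]); last exact: closed_ge.
  by move=> p _; apply: ctw.
have S0 : S !=set0.
  by exists (x0, y0); rewrite /S /J /tw /= ux uy; split.
have [[x1 y1]] := compact_EVT_min S0 cS (continuous_subspaceT (fun p => @cvg_snd _ _ _ _ _)).
rewrite inE => -[/= /andP[ux1 uy1] [J1 tw1]] min1.
have inner x y : unit_itv x -> unit_itv y -> jacT T x y z <= 0 -> 0 < x < 1 /\ 0 < y < 1.
  move=> vx vy; have := bd x y z; rewrite /on_bd vx vy uz /=.
  move: vx vy; rewrite /unit_itv => /andP[a b] /andP[c d] bd' Jxy.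
  have {bd'} : ~~ [|| x == 0, x == 1, y == 0, y == 1, z == 0 | z == 1].
    by apply/negP => /bd'; rewrite ltNge Jxy.
  rewrite !negb_or !lt_neqAle a b c d => /and5P[n1 n2 n3 n4 _].
  by rewrite ![0 == _]eq_sym n1 n2 n3 n4.
have [x1i y1i] := inner _ _ ux1 uy1 J1.
have twy := twist_neq0 bd ux1 uy1 uz J1.
have twp : 0 < tw y1 by rewrite lt_neqAle tw1 eq_sym mulf_neq0.
have [d1 [d2 [m [lE dE]]]] := jacT_line T x1 y1 z.
have disc : 0 < d1 ^+ 2 - 4 * jacT T x1 y1 z * d2.
  by rewrite dE ltr_wpDl ?sqr_ge0 // mulr_gt0.
have [h uh Jh] := quadratic_neg x1i J1 disc.
have c1 : J (x1 + h, y) @[y --> y1] --> J (x1 + h, y1).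
  apply: (@cvg_jacT _ _ _ _ _ (fun _ => x1 + h) id (fun _ => z));
    [exact: cvg_cst|exact: cvg_id|exact: cvg_cst].
have c2 : tw y @[y --> y1] --> tw y1.
  apply: cvgM; last exact: cvg_cst.
  by apply: (@cvg_twist _ _ _ _ T id y1); exact: cvg_id.
(* Strict inequalities survive a small decrease of y at [x1 + h], which yields a point of [S] below
   [y1]. *)
have n1 : \forall y \near y1, J (x1 + h, y) < 0.
  by apply: (cvgr_lt _ c1); rewrite /J /= lE.
have n2 : \forall y \near y1, 0 < tw y by apply: (cvgr_gt _ c2).
have n3 : \forall y \near y1, 0 < y by apply: lt_nbhsr; case/andP: y1i.
have [e /= e0 be] := (nbhs_ballP y1 _).1 (filterI n1 (filterI n2 n3)).
have e1 : 0 < e / 2 by rewrite divr_gt0.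
have [/ltW Jl [/ltW tl yl]] : [set y | J (x1 + h, y) < 0 /\ 0 < tw y /\ 0 < y] (y1 - e / 2).
  apply: be; rewrite /ball /= opprB addrC subrK gtr0_norm //; lra.
have /min1 /= : (x1 + h, y1 - e / 2) \in S.
  rewrite inE; split=> //=; rewrite uh /= /unit_itv (ltW yl) /=.
  by move: y1i => /andP[_ ?]; lra.
by lra.
Qed.

Lemma bd_pos_turn T : (forall x y z, on_bd x y z -> 0 < jacT T x y z) ->
  forall x y z, on_bd x y z -> 0 < jacT (turn T) x y z.
Proof. by move=> bd x y z b; rewrite jacT_turn; apply: bd; rewrite -on_bd_turn. Qed.

(** If the first two products are negative, then [c * a * b ^+ 2], which equals their product, is
    positive. *)
Lemma mulr3_sign (a b c : R) : [|| 0 <= a * b, 0 <= b * c | 0 <= c * a].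
Proof.
have [//|ab] /= := leP 0 (a * b); have [//|bc] /= := leP 0 (b * c).
have b2 : 0 <= b ^+ 2 by apply: sqr_ge0.
have p : 0 < a * b * (b * c) by rewrite nmulr_rgt0.
rewrite leNgt; apply/negP => /ltW ca; have := mulr_le0_ge0 ca b2.
by rewrite (_ : c * a * _ = a * b * (b * c)) ?leNgt ?p //; ring.
Qed.

Lemma jacT_pos T : (forall x y z, on_bd x y z -> 0 < jacT T x y z) ->
  forall x y z, unit_itv x -> unit_itv y -> unit_itv z -> 0 < jacT T x y z.
Proof.
move=> bd x y z ux uy uz; rewrite ltNge; apply/negP => J0.
have bd' := bd_pos_turn bd; have bd'' := bd_pos_turn bd'.
have J1 : jacT (turn T) y z x <= 0 by rewrite jacT_turn.
have J2 : jacT (turn (turn T)) z x y <= 0 by rewrite jacT_turn.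
have tA := twist_neq0 bd ux uy uz J0.
have tB := twist_neq0 bd' uy uz ux J1.
have tC := twist_neq0 bd'' uz ux uy J2.
(* A cyclic relabelling brings the pair of equal sign to the front; in the last case the third turn
   leads back to [T]. *)
have [s|s|s] := or3P (mulr3_sign (twist T y) (twist (turn T) z) (twist (turn (turn T)) x)).
- by have := twist_same_sign_pos bd ux uy uz s tB; rewrite ltNge J0.
- by have := twist_same_sign_pos bd' uy uz ux s tC; rewrite ltNge J1.
- have := @twist_same_sign_pos _ bd'' z x y uz ux uy; rewrite turnK => /(_ s tA).
  by rewrite ltNge J2.
Qed.

(** With [d1 = 0] the discriminant identity makes - 4 J d2 nonnegative, so [d2 <= 0], while
    minimality gives [0 <= d2]. *)
Lemma interior_min_line T x y z : 0 < x < 1 -> 0 < jacT T x y z ->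
  0 <= twist T y * twist (turn T) z ->
  (forall x', unit_itv x' -> jacT T x y z <= jacT T x' y z) ->
  jacT T 0 y z = jacT T x y z.
Proof.
move=> x01 J0 tw0 min.
have [d1 [d2 [m [lE dE]]]] := jacT_line T x y z.
have [|d10 d2_ge0] := @quadratic_min d1 d2 x x01.
  by move=> h /min; rewrite lE -addrA lerDl.
have d20 : d2 = 0.
  apply/eqP; rewrite eq_le d2_ge0 andbT -(pmulr_rle0 _ J0).
  by move: dE; rewrite d10 expr0n /=; have := sqr_ge0 m; nra.
by rewrite -[0 in LHS](addrN x) lE d10 d20 !mul0r !addr0.
Qed.

Lemma compact_unit_cube :
  compact ([set p : R * R * R | [&& unit_itv p.1.1, unit_itv p.1.2 & unit_itv p.2]]).
Proof.
rewrite (_ : [set _ | _] = [set p : R * R | unit_itv p.1 && unit_itv p.2] `*` `[0, 1]); last first.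
  apply/seteqP; split=> -[[x y] z] /=; rewrite in_itv /= /unit_itv.
    by move=> /and3P[-> -> ->].
  by move=> [/andP[-> ->] ->].
by apply: compact_setX; [exact: compact_unit_square|exact: segment_compact].
Qed.

Lemma jacT_min_bd T : (forall x y z, on_bd x y z -> 0 < jacT T x y z) ->
  exists x y z, on_bd x y z /\
  forall x' y' z', unit_itv x' -> unit_itv y' -> unit_itv z' ->
    jacT T x y z <= jacT T x' y' z'.
Proof.
move=> bd.
have cJ : continuous (fun p : R * R * R => jacT T p.1.1 p.1.2 p.2).
  move=> p; apply: cvg_jacT; last exact: continuous_snd.
    exact: (cvg_comp _ _ (@continuous_fst _ _ _) (@continuous_fst _ _ _)).
  exact: (cvg_comp _ _ (@continuous_fst _ _ _) (@continuous_snd _ _ _)).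
have u0 := @unit0 R.
have [|[[x y] z]] := compact_EVT_min _ compact_unit_cube (continuous_subspaceT cJ).
  by exists (0, 0, 0) => /=; rewrite u0.
rewrite inE /= => /and3P[ux uy uz] min0.
have min x' y' z' : unit_itv x' -> unit_itv y' -> unit_itv z' ->
    jacT T x y z <= jacT T x' y' z'.
  by move=> a b c; apply: (min0 (x', y', z')); rewrite inE /= a b c.
have [b|] := boolP (on_bd x y z); first by exists x, y, z.
rewrite /on_bd ux uy uz /= !negb_or => /and5P[x0 x1 y0 y1 /andP[z0 z1]].
have [xi yi zi] : [/\ 0 < x < 1, 0 < y < 1 & 0 < z < 1].
  move: ux uy uz => /andP[? ?] /andP[? ?] /andP[? ?].
  by rewrite !lt_neqAle ![0 == _]eq_sym x0 x1 y0 y1 z0 z1; split; apply/andP.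
have J0 := jacT_pos bd ux uy uz.
(* The pair of equal sign selects the coordinate line along which the minimum slides to a face. *)
have [s|s|s] := or3P (mulr3_sign (twist T y) (twist (turn T) z) (twist (turn (turn T)) x)).
- exists 0, y, z; split; first by rewrite /on_bd u0 uy uz eqxx.
  by rewrite (interior_min_line xi J0 s) // => x' ux'; apply: min.
- exists x, 0, z; split; first by rewrite /on_bd ux u0 uz eqxx !orbT.
  rewrite -jacT_turn (@interior_min_line (turn T) y z x) ?jacT_turn //.
  by move=> y' uy'; rewrite !jacT_turn; apply: min.
- exists x, y, 0; split; first by rewrite /on_bd ux uy u0 eqxx !orbT.
  rewrite -jacT_turn -jacT_turn (@interior_min_line (turn (turn T)) z x y) ?jacT_turn ?turnK //.
  by move=> z' uz'; rewrite !jacT_turn; apply: min.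
Qed.
End Positivity.

(** * The minimum on a face *)

Section Polynomials.
Variable R : realType.
Implicit Types (f : R -> R -> R) (g : R -> R) (a b c p : {poly R}).

Lemma horner_size3 p t : (size p <= 3)%N ->
  p.[t] = p`_0 + p`_1 * t + p`_2 * t ^+ 2.
Proof.
by move=> sp; rewrite (horner_coef_wide _ sp) !big_ord_recl big_ord0 /= expr0 expr1; ring.
Qed.

Lemma horner_deriv_size3 p t : (size p <= 3)%N ->
  p^`().[t] = p`_1 + 2 * p`_2 * t.
Proof.
move=> sp; have sd : (size p^`() <= 2)%N.
  by apply: leq_trans (size_poly _ _) _; case: (size p) sp => [|[|[|[]]]].
rewrite (horner_coef_wide _ sd) !big_ord_recl big_ord0 /= !coef_deriv /=.
rewrite expr0 -[bump 0 0]/1%N; ring.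
Qed.

Definition quadratic_on_unit g := exists d2 d1 d0 : R,
  forall u : R, 0 <= u <= 1 -> g u = d2 * u ^+ 2 + d1 * u + d0.

(** An interior minimizer of a quadratic is its vertex, unless the leading coefficient is 0; then
    [g] is constant and the endpoint 0 serves as well. *)
Lemma edge_min g r : quadratic_on_unit g -> unit_itv r ->
  (forall u, unit_itv u -> g r <= g u) ->
  exists r', [/\ (r' = 0 \/ r' = 1) \/ edge_vertex g r', unit_itv r' & g r' = g r].
Proof.
move=> [d2 [d1 [d0 gE]]] ur min.
have [r0|r0] := eqVneq r 0; first by exists r; split=> //; left; left.
have [r1|r1] := eqVneq r 1; first by exists r; split=> //; left; right.
have r01 : 0 < r < 1.
  by move: ur => /andP[? ?]; rewrite !lt_neqAle [0 == _]eq_sym r0 r1; apply/andP.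
have [h|e0 d2_ge0] := @quadratic_min _ (2 * d2 * r + d1) d2 r r01.
  by move=> uh; have := min _ uh; rewrite !gE // -subr_ge0; congr (0 <= _); ring.
have [d20|d2N0] := eqVneq d2 0.
  have d10 : d1 = 0 by move: e0; rewrite d20; lra.
  have u0 := @unit0 R.
  by exists 0; split; [left; left|exact: u0|rewrite !gE // d20 d10; ring].
exists r; split=> //; right; exists d2, d1, d0; split => //.
  by rewrite lt_neqAle eq_sym d2N0.
have -> : d1 = - (2 * d2 * r) by lra.
by field.
Qed.

(** The values at 0, 1/2 and 1 determine a quadratic. *)
Lemma quadratic_unit_eq (d2 d1 d0 e2 e1 e0 : R) :
  (forall u, unit_itv u -> d2 * u ^+ 2 + d1 * u + d0 = e2 * u ^+ 2 + e1 * u + e0) ->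
  [/\ d2 = e2, d1 = e1 & d0 = e0].
Proof.
move=> H; have := H 0; have := H 1; have := H (2^-1).
rewrite /unit_itv !expr2 !mulr0 !mulr1 => H2 H1 H0.
have {}H0 := H0 ltac:(lra); have {}H1 := H1 ltac:(lra); have {}H2 := H2 ltac:(lra).
by split; lra.
Qed.

Lemma edge_vertex_unique g r r' : edge_vertex g r -> edge_vertex g r' -> r = r'.
Proof.
move=> [d2 [d1 [d0 [gE _ -> _]]]] [e2 [e1 [e0 [gE' _ -> _]]]].
by have [u u01|-> -> _] := @quadratic_unit_eq d2 d1 d0 e2 e1 e0; rewrite // -gE // gE'.
Qed.

(** The segment is parametrized so that [x] and [y] may come in either order. *)
Lemma poly_ivt_seg p (x y : R) : p.[x] <= 0 <= p.[y] ->
  exists2 l, unit_itv l & root p (x + l * (y - x)).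
Proof.
move=> pxy; pose q := p \Po (x%:P + (y - x) *: 'X).
have qE l : q.[l] = p.[x + l * (y - x)].
  by rewrite /q horner_comp !hornerE [l * _]mulrC.
have [|l l01 ql] := @poly_ivt _ q _ _ (@ler01 R).
  by rewrite !qE mul0r mul1r addr0 addrC subrK.
by exists l; rewrite // /root -qE.
Qed.

(* The quotient e / a has zero derivative and vanishes at t. *)
Lemma wronskian0_root (a e : {poly R}) (t : R) :
  a * e^`() = a^`() * e -> a.[t] != 0 -> e.[t] = 0 -> e = 0.
Proof.
move=> ode at0 et0; apply/eqP/negPn/negP => eN0.
have [n [q]] := multiplicity_XsubC e t; rewrite eN0 /= => qt eE.
case: n eE => [|n] eE.
  by move: qt; rewrite /root -[q]mulr1 -(expr0 ('X - t%:P)) -eE et0 eqxx.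
move: ode; rewrite eE derivM deriv_exp derivXsubC mul1r /= exprS.
have LN0 : ('X - t%:P) ^+ n != 0 by rewrite expf_neq0 // polyXsubC_eq0.
rewrite (_ : a * _ = (a * (q^`() * ('X - t%:P) + q *+ n.+1)) * ('X - t%:P) ^+ n); last first.
  by rewrite -mulr_natr; ring.
rewrite (_ : a^`() * _ = (a^`() * q * ('X - t%:P)) * ('X - t%:P) ^+ n); last by ring.
(* Cancelling (X - t)^n and evaluating at [t] leaves a(t) q(t) (n + 1) = 0, although neither a(t)
   nor q(t) is 0. *)
move/(mulIf LN0)/(congr1 (horner^~ t)).
rewrite !hornerE hornerMn subrr !mulr0 add0r => /eqP.
by rewrite mulf_eq0 (negPf at0) /= mulrn_eq0 /= -/(root q t) (negPf qt).
Qed.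

End Polynomials.

(** * Minimizers of a face form on the unit square *)

Section FaceMin.
Variable R : realType.
Implicit Types (f : R -> R -> R) (g : R -> R) (a b c p : {poly R}).


Lemma face_form_edges f a b c : face_form f a b c ->
  (forall e, e = 0 \/ e = 1 -> quadratic_on_unit (fun r => f e r)) /\
  (forall e, e = 0 \/ e = 1 -> quadratic_on_unit (fun r => f r e)).
Proof.
move=> [sa sb sc fE]; have sa' : (size a <= 3)%N by apply: leq_trans sa _.
split=> e e01; have ue : 0 <= e <= 1 by case: e01 => ->; rewrite ?lexx ler01.
  exists (a`_2 * e ^+ 2 + b`_2 * e + c`_2), (a`_1 * e ^+ 2 + b`_1 * e + c`_1),
    (a`_0 * e ^+ 2 + b`_0 * e + c`_0) => u uu.
  by rewrite fE // !horner_size3 //; ring.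
by exists a.[e], b.[e], c.[e] => u uu; rewrite fE.
Qed.

Definition unit_square_min f (s t : R) := [/\ unit_itv s, unit_itv t &
  forall s' t', unit_itv s' -> unit_itv t' -> f s t <= f s' t'].

(** A minimizer of the square lying on an edge minimizes on that edge, so [edge_min] replaces it by
    a corner or a vertex of equal value. *)
Lemma perimeter_min f a b c s t : face_form f a b c -> unit_square_min f s t ->
  [\/ s = 0, s = 1, t = 0 | t = 1] ->
  exists s' t', face_cand f (s', t') /\ unit_square_min f s' t'.
Proof.
move=> /face_form_edges[fx fy] [us ut min] st.
have u0 := @unit0 R; have u1 := @unit1 R.
have vert e : e = 0 \/ e = 1 -> s = e -> exists s' t',
    face_cand f (s', t') /\ unit_square_min f s' t'.
  move=> e01 se; subst s.
  have [|r [rc ur rE]] := edge_min (fx e e01) ut; first by move=> u uu; apply: min.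
  exists e, r; split; last by split=> // s' t' us' ut'; rewrite rE min.
  left; case: rc => [r01|rv]; first by do 4! left.
  by case: e01 rv {us min rE} => -> rv; [do 3! left; right|do 2! left; right]; exists r.
have horiz e : e = 0 \/ e = 1 -> t = e -> exists s' t',
    face_cand f (s', t') /\ unit_square_min f s' t'.
  move=> e01 te; subst t.
  have [|r [rc ur rE]] := edge_min (fy e e01) us; first by move=> u uu; apply: min.
  exists r, e; split; last by split=> // s' t' us' ut'; rewrite rE min.
  left; case: rc => [r01|rv]; first by do 4! left.
  by case: e01 rv {ut min rE} => -> rv; [left; right|right]; exists r.
by case: st; [apply: vert; left|apply: vert; right|apply: horiz; left|apply: horiz; right].
Qed.

(* Moving t towards the endpoint where the affine function a is largest, the
   zero s = - b / (2 a) stays in the square until it meets the perimeter. *)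
Lemma zero_on_perimeter a b (t0 : R) : (size a <= 2)%N -> unit_itv t0 ->
  0 < a.[t0] -> b.[t0] < 0 -> 0 < 2 * a.[t0] + b.[t0] ->
  exists s t, [/\ unit_itv s, unit_itv t, [\/ s = 0, s = 1, t = 0 | t = 1],
    0 < a.[t] & 2 * a.[t] * s + b.[t] = 0].
Proof.
move=> sa ut0 at0 bt0 abt0.
have aE t : a.[t] = a`_0 + a`_1 * t.
  by rewrite (horner_coef_wide _ sa) !big_ord_recl big_ord0 /= expr0; ring.
have [t1 t1b at1] : exists2 t1, t1 = 0 \/ t1 = 1 & a.[t0] <= a.[t1].
  move: ut0 => /andP[t00 t01].
  have [a1|a1] := leP 0 a`_1; [exists 1; [by right|]|exists 0; [by left|]];
    by rewrite !aE; nra.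
have ut1 : unit_itv t1 by case: t1b => ->; rewrite (@unit0 R, @unit1 R).
have seg l : unit_itv l -> unit_itv (t0 + l * (t1 - t0)) /\ 0 < a.[t0 + l * (t1 - t0)].
  move: ut0 ut1 => /andP[? ?] /andP[? ?] /andP[? ?]; split.
    by rewrite /unit_itv; apply/andP; split; nra.
  rewrite (_ : a.[_] = a.[t0] + l * (a.[t1] - a.[t0])); last by rewrite !aE; ring.
  by nra.
(* If [b] changes sign on the way, s reaches 0; if 2 a + b does, s reaches 1; otherwise s is still
   in [0, 1] at [t1]. *)
have [bt1|bt1] := leP b.[t1] 0; last first.
  have [|l ul rl] := @poly_ivt_seg _ b t0 t1; first by rewrite !ltW.
  have [ut at_] := seg _ ul; exists 0, (t0 + l * (t1 - t0)).
  by split => //; [exact: @unit0 R|exact: Or41|rewrite mulr0 add0r; apply/eqP].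
have [abt1|abt1] := leP 0 (2 * a.[t1] + b.[t1]); last first.
  have [|l ul rl] := @poly_ivt_seg _ (- (2 *: a + b)) t0 t1.
    by rewrite !(hornerD, hornerN, hornerZ, hornerM, horner_exp) oppr_le0 oppr_ge0 !ltW.
  have [ut at_] := seg _ ul; exists 1, (t0 + l * (t1 - t0)).
  split => //; [exact: @unit1 R|exact: Or42|rewrite mulr1].
  by move: rl; rewrite rootN /root !(hornerD, hornerN, hornerZ, hornerM, horner_exp) => /eqP.
have at1' : 0 < a.[t1] by apply: lt_le_trans at1.
exists (- b.[t1] / (2 * a.[t1])), t1; split=> //.
- have a2 : 0 < 2 * a.[t1] by rewrite mulr_gt0.
  by rewrite /unit_itv ler_pdivlMr // ler_pdivrMr // mul0r mul1r; apply/andP; split; lra.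
- by case: t1b; [exact: Or43|exact: Or44].
- by field; rewrite gt_eqF.
Qed.

(* Here P = 0 forces 4 a c - b^2 = 4 m a with m the minimum, that is
   4 a (f - m) = (2 a s + b)^2, so f = m along the curve s = - b / (2 a). *)
Lemma degenerate_min f a b c s t : face_form f a b c -> unit_square_min f s t ->
  face_poly a b c = 0 -> 0 < s < 1 -> 0 < a.[t] -> 2 * a.[t] * s + b.[t] = 0 ->
  exists s' t', unit_square_min f s' t' /\ [\/ s' = 0, s' = 1, t' = 0 | t' = 1].
Proof.
move=> [sa sb sc fE] [us ut min] P0 s01 at0 bt0.
pose e : {poly R} := 4 *: (a * c) - b ^+ 2 - (4 * f s t) *: a.
have e0 : e = 0.
  apply: (@wronskian0_root _ a e t); last 2 first.
  - by rewrite gt_eqF.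
  - rewrite /e !(hornerD, hornerN, hornerZ, hornerM, horner_exp) fE //.
    by rewrite (_ : b.[t] = - (2 * a.[t] * s)); [ring|lra].
  (* P is the Wronskian a e' - a' e; the multiple of [a] subtracted in [e] does not affect it. *)
  apply/eqP; rewrite -subr_eq0 -P0 /face_poly /e; apply/eqP.
  rewrite [b ^+ 2]expr2 !(derivB, derivZ, derivM) -!mul_polyC; ring.
have sq s' t' : unit_itv s' -> unit_itv t' ->
    4 * a.[t'] * (f s' t' - f s t) = (2 * a.[t'] * s' + b.[t']) ^+ 2.
  move=> us' ut'; apply/eqP; rewrite -subr_eq0; apply/eqP.
  have := congr1 (horner^~ t') e0.
  rewrite /e !(hornerD, hornerN, hornerZ, hornerM, horner_exp, horner0) => et'.
  by rewrite (fE s' t') // -[RHS]et'; ring.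
have [|| s' [t' [us' ut' st' at' bt']]] := @zero_on_perimeter a b t sa ut at0.
- by nra.
- by nra.
exists s', t'; split=> //; have := sq s' t' us' ut'.
rewrite bt' expr0n /= => /eqP; rewrite mulf_eq0 mulf_eq0 (gt_eqF at') pnatr_eq0 /=.
by rewrite subr_eq0 => /eqP st; split=> // x y ux uy; rewrite st min.
Qed.

Lemma unit_square_min_exists f a b c : face_form f a b c ->
  exists s t, unit_square_min f s t.
Proof.
move=> [sa sb sc fE].
(* [f] is known only on the square, so continuity is argued for its polynomial extension. *)
pose F (q : R * R) := a.[q.2] * q.1 ^+ 2 + b.[q.2] * q.1 + c.[q.2].
have cp p : continuous (fun q : R * R => p.[q.2]).
  move=> q; apply: (cvg_comp _ _ (@continuous_snd _ _ q)).
  exact: continuous_horner.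
have cF : continuous F.
  move=> q; rewrite /continuous_at /F; apply: cvgD; last exact: cp.
  by apply: cvgD; apply: cvgM; try exact: cp; rewrite ?expr2;
    [apply: cvgM|]; exact: continuous_fst.
have [|[s t]] := compact_EVT_min _ (@compact_unit_square R) (continuous_subspaceT cF).
  by exists (0, 0) => /=; rewrite (@unit0 R).
rewrite inE /= => /andP[us ut] min; exists s, t; split=> // s' t' us' ut'.
by rewrite !fE //; apply: (min (s', t')); rewrite inE /= us' ut'.
Qed.

Lemma face_min f a b c : face_form f a b c ->
  exists s t, face_cand f (s, t) /\ unit_square_min f s t.
Proof.
move=> ff; have [s [t stmin]] := unit_square_min_exists ff.
have [us ut min] := stmin; have [sa sb sc fE] := ff.
have u0 := @unit0 R.
have [s0|s0] := eqVneq s 0; first by apply: (perimeter_min ff stmin); exact: Or41.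
have [s1|s1] := eqVneq s 1; first by apply: (perimeter_min ff stmin); exact: Or42.
have [t0|t0] := eqVneq t 0; first by apply: (perimeter_min ff stmin); exact: Or43.
have [t1|t1] := eqVneq t 1; first by apply: (perimeter_min ff stmin); exact: Or44.
have [s01 t01] : 0 < s < 1 /\ 0 < t < 1.
  move: us ut => /andP[? ?] /andP[? ?].
  by rewrite !lt_neqAle ![0 == _]eq_sym s0 s1 t0 t1; split; apply/andP.
have [h|fs a_ge0] := @quadratic_min _ (2 * a.[t] * s + b.[t]) a.[t] s s01.
  by move=> uh; have := min _ _ uh ut; rewrite !fE // -subr_ge0; congr (0 <= _); ring.
(* If a(t) = 0, then b(t) = 0 as well, so [f] is constant in s and the minimum is attained at s =
   0. *)
have [a0|aN0] := eqVneq a.[t] 0.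
  have b0 : b.[t] = 0 by move: fs; rewrite a0; lra.
  have : unit_square_min f 0 t.
    split=> // s' t' us' ut'.
    by rewrite (_ : f 0 t = f s t) ?min // !fE // a0 b0 !mul0r.
  by move/(perimeter_min ff); apply; exact: Or41.
have a_gt0 : 0 < a.[t] by rewrite lt_neqAle eq_sym aN0.
have [P0|PN0] := eqVneq (face_poly a b c) 0.
  have [s' [t' [min' per]]] := degenerate_min ff stmin P0 s01 a_gt0 fs.
  exact: (perimeter_min ff min' per).
exists s, t; split=> //; right; exists a, b, c; split=> //=; last first.
  by split=> //; rewrite (_ : b.[t] = - (2 * a.[t] * s)); [field|lra].
(* [p] is [f] at fixed [s]; minimality in t makes its derivative vanish at [t]. *)
split=> //; pose p := s ^+ 2 *: a + s *: b + c.
have sp : (size p <= 3)%N.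
  rewrite (leq_trans (size_polyD _ _)) // geq_max sc andbT.
  rewrite (leq_trans (size_polyD _ _)) // geq_max !(leq_trans (size_scale_leq _ _)) //.
  exact: leq_trans sa _.
have pE t' : p.[t'] = a.[t'] * s ^+ 2 + b.[t'] * s + c.[t'].
  by rewrite !(hornerD, hornerZ); ring.
have [h|ft _] := @quadratic_min _ (p`_1 + 2 * p`_2 * t) p`_2 t t01.
  move=> uh; have := min _ _ us uh; rewrite !fE // -!pE !horner_size3 // -subr_ge0.
  by congr (0 <= _); ring.
have dp : p^`() = s ^+ 2 *: a^`() + s *: b^`() + c^`() by rewrite /p !(derivD, derivZ).
move: ft; rewrite -horner_deriv_size3 // dp !(hornerD, hornerZ) => ft.
rewrite /root /face_poly !(hornerD, hornerN, hornerZ, hornerM, horner_exp).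
rewrite (_ : b.[t] = - (2 * a.[t] * s)); last by lra.
(* P(t) is 4 a(t)^2 times the t-derivative of f at s = - b / (2 a). *)
rewrite (_ : _ + _ = 4 * a.[t] ^+ 2 *
  (s ^+ 2 * a^`().[t] + s * b^`().[t] + c^`().[t])); last by ring.
by rewrite ft mulr0.
Qed.
End FaceMin.

(** * Finiteness of the candidate set *)

Section Finiteness.
Variable R : realType.
Implicit Types (f : R -> R -> R) (g : R -> R) (a b c p q : {poly R}).

Lemma finite_roots p : p != 0 -> finite_set [set x | root p x].
Proof.
move=> pN0; apply: contrapT => /(infinite_set_fset (size p))[B rB sB].
have : (size (finmap.enum_fset B) < size p)%N.
  by apply: max_poly_roots => //; [apply/allP => x /rB|exact: finmap.fset_uniq].
by rewrite ltnNge sB.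
Qed.

Lemma edge_vertex_finite g : finite_set (edge_vertex g).
Proof.
have [[r gr]|N] := pselect (exists r, edge_vertex g r).
  by apply: (@sub_finite_set _ _ [set r]) => // r' gr'; apply: edge_vertex_unique gr' gr.
by rewrite (_ : edge_vertex g = set0) // -subset0 => r gr; apply: N; exists r.
Qed.

Lemma poly3_unit_eq p q : (size p <= 3)%N -> (size q <= 3)%N ->
  (forall t, unit_itv t -> p.[t] = q.[t]) -> p = q.
Proof.
move=> sp sq pq; have [u|e2 e1 e0] := @quadratic_unit_eq R p`_2 p`_1 p`_0 q`_2 q`_1 q`_0.
  by move=> /pq; rewrite !horner_size3 // => pqu; lra.
apply/polyP => -[|[|[|n]]] //; rewrite !nth_default //.
  exact: leq_trans sq _.
exact: leq_trans sp _.
Qed.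

(** Coefficients are compared first in s at each fixed t, then in t. Hence all interior candidates
    of a face come from one and the same P. *)
Lemma face_form_unique f a b c a' b' c' :
  face_form f a b c -> face_form f a' b' c' -> [/\ a = a', b = b' & c = c'].
Proof.
move=> [sa sb sc fE] [sa' sb' sc' fE'].
have E t : unit_itv t -> [/\ a.[t] = a'.[t], b.[t] = b'.[t] & c.[t] = c'.[t]].
  by move=> ut; apply: quadratic_unit_eq => s us; rewrite -fE // -fE'.
split; apply: poly3_unit_eq => //; try exact: leq_trans _ (leqnSn 2).
- by move=> t /E[].
- by move=> t /E[].
- by move=> t /E[].
Qed.

Lemma interior_cand_finite f : finite_set (interior_cand f).
Proof.
have [[q [a [b [c [ff PN0 _ _ _]]]]]|N] := pselect (interior_cand f !=set0); last first.
  by rewrite (_ : interior_cand f = set0) // -subset0 => q fq; apply: N; exists q.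
apply: (@sub_finite_set _ _
  [set (- b.[t] / (2 * a.[t]), t) | t in [set x | root (face_poly a b c) x]]).
  move=> [s t] [a' [b' [c' [ff' _ /= [_ rt] _ [-> _]]]]].
  have [ea eb ec] := face_form_unique ff ff'.
  by subst a' b' c'; exists t.
by apply: finite_image; apply: finite_roots.
Qed.

Lemma face_cand_finite f : finite_set (face_cand f).
Proof.
rewrite /face_cand /perimeter_cand !finite_setU; split; last exact: interior_cand_finite.
do 4! (split; last by apply: finite_image; exact: edge_vertex_finite).
apply: (@sub_finite_set _ _ ([set 0; 1] `*` [set 0; 1])).
  by move=> [s t] /= [].
by apply: finite_setX; apply: finite_set2.
Qed.

Lemma face_cand_unit f s t : face_cand f (s, t) -> unit_itv s /\ unit_itv t.
Proof.
have E g r : edge_vertex g r -> unit_itv r.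
  by move=> [? [? [? [_ _ _ /andP[/ltW ? /ltW ?]]]]]; apply/andP.
have U (e : R) : e = 0 \/ e = 1 -> unit_itv e by case=> ->; rewrite (unit0, unit1).
case=> [[[[[[/= s01 t01]|]|]|]|]|]; first by split; apply: U.
- by move=> [r /E ur [<- <-]]; rewrite unit0.
- by move=> [r /E ur [<- <-]]; rewrite unit1.
- by move=> [r /E ur [<- <-]]; rewrite unit0.
- by move=> [r /E ur [<- <-]]; rewrite unit1.
move=> [a [b [c [_ _ /= [/andP[/ltW t0 /ltW t1] _] _ [_ /andP[/ltW s0 /ltW s1]]]]]].
by split; apply/andP.
Qed.

(* All monomials s^i t^j with i, j <= 2 except s^2 t^2. *)
Definition serendipity f := exists k00 k10 k20 k01 k11 k21 k02 k12 : R,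
  forall s t, unit_itv s -> unit_itv t ->
  f s t = k00 + k10 * s + k20 * s ^+ 2 + k01 * t + k11 * s * t
    + k21 * s ^+ 2 * t + k02 * t ^+ 2 + k12 * s * t ^+ 2.

Lemma serendipity_swap f : serendipity f -> serendipity (fun s t => f t s).
Proof.
move=> [k00 [k10 [k20 [k01 [k11 [k21 [k02 [k12 fE]]]]]]]].
exists k00, k01, k02, k10, k11, k12, k20, k21 => s t us ut; rewrite fE //; ring.
Qed.

Lemma serendipity_face_form f : serendipity f -> exists a b c, face_form f a b c.
Proof.
move=> [k00 [k10 [k20 [k01 [k11 [k21 [k02 [k12 fE]]]]]]]].
exists (Poly [:: k20; k21]), (Poly [:: k10; k11; k12]), (Poly [:: k00; k01; k02]).
split; try exact: size_Poly.
by move=> s t us ut; rewrite fE // !horner_Poly /=; ring.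
Qed.

(** On this face F_y and F_z have the same mixed derivative [Q1], so their cross product has only
    the monomials 1, s, t; with 1, s, t, st from F_x no s^2 t^2 arises. *)
Lemma jacT_serendipity (T : trilin R) (e : R) : serendipity (fun s t => jacT T e s t).
Proof.
case: T => A B C u v w q.
pose Q0 := B + e *: u; pose Q1 := w + e *: q; pose S0 := C + e *: v.
exists (det3 A Q0 S0), (det3 A Q0 Q1 + det3 u Q0 S0), (det3 u Q0 Q1),
  (det3 A Q1 S0 + det3 v Q0 S0),
  (det3 v Q0 Q1 + det3 u Q1 S0 + det3 q Q0 S0), (det3 q Q0 Q1),
  (det3 v Q1 S0), (det3 q Q1 S0) => s t _ _.
rewrite /jacT (_ : dy _ _ _ = Q0 + t *: Q1); last first.
  by apply/matrixP => i j; rewrite !mxE /=; ring.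
rewrite (_ : dz _ _ _ = S0 + s *: Q1); last first.
  by apply/matrixP => i j; rewrite !mxE /=; ring.
move: Q0 Q1 S0 => Q0 Q1 S0; rewrite /dx /= /det3 !mxE; ring.
Qed.
End Finiteness.

(** * From the one-sided derivatives to the trilinear coefficients *)

Section Hexahedra.
Variable R : realType.
Implicit Types (F : 'cV[R]_3 -> 'cV[R]_3) (p : 'cV[R]_3) (i : 'I_3).

Lemma ord3P i : [\/ i = 0, i = 1 | i = 2%:R].
Proof.
by case: i => -[|[|[|//]]] h; [apply: Or31|apply: Or32|apply: Or33]; apply: val_inj.
Qed.

Lemma ptE (x y z : R) : [/\ pt x y z 0 0 = x, pt x y z 1 0 = y & pt x y z 2%:R 0 = z].
Proof. by split; rewrite mxE. Qed.

Lemma pt_coord p : p = pt (p 0 0) (p 1 0) (p 2%:R 0).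
Proof.
apply/matrixP => i j; rewrite ord1.
by case: (ord3P i) => ->; rewrite mxE.
Qed.

Lemma cube_pt (x y z : R) :
  cube (pt x y z) <-> [/\ unit_itv x, unit_itv y & unit_itv z].
Proof.
have [ex ey ez] := ptE x y z; split.
  by move=> c; move: (c 0) (c 1) (c 2%:R); rewrite ex ey ez.
by move=> [ux uy uz] i; case: (ord3P i) => ->; rewrite ?ex ?ey ?ez.
Qed.

Lemma det3E (a b c : 'cV[R]_3) (M : 'M[R]_3) :
  (forall k, [/\ M k 0 = a k 0, M k 1 = b k 0 & M k 2%:R = c k 0]) ->
  \det M = det3 a b c.
Proof.
move=> H.
have [e00 e01 e02] := H 0; have [e10 e11 e12] := H 1; have [e20 e21 e22] := H 2%:R.
rewrite (expand_det_row _ 0) !big_ord_recl big_ord0 /cofactor.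
rewrite !(expand_det_row _ 0) !big_ord_recl !big_ord0 /cofactor !det_mx11 !mxE /=.
rewrite /det3 -e00 -e01 -e02 -e10 -e11 -e12 -e20 -e21 -e22.
(* Indexing by natural numbers lets different expressions of the same ordinal be identified by
   computation. *)
have [m E] : exists m : nat -> nat -> R, forall i j, M i j = m i j.
  by exists (fun k l => M (inord k) (inord l)) => i j; rewrite !inord_val.
rewrite !E /= /bump /=; ring.
Qed.

(** The difference quotient equals [u] for every admissible increment; the limit is then [u] because
    admissible increments exist arbitrarily close to 0. *)
Lemma partialE F i p (u v : 'cV[R]_3) : cube p ->
  (forall t, unit_itv t -> F (set_coord p i t) = t *: u + v) -> partial F i p = u.
Proof.
move=> cp Fp.
have sE h : h *: delta_mx i 0 + p = set_coord p i (h + p i 0).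
  apply/matrixP => k j; rewrite !mxE ord1 eqxx andbT.
  by case: eqP => [->|_]; rewrite ?mulr1 // mulr0 add0r.
have up := cp i.
have cE h : cube (h *: delta_mx i 0 + p) <-> unit_itv (h + p i 0).
  rewrite sE; split=> [/(_ i)|uh k]; first by rewrite mxE eqxx.
  by rewrite mxE; case: eqP => // _; apply: cp.
rewrite /partial; set G := within _ _.
have PG : ProperFilter G.
  apply: Build_ProperFilter_ex => P /nbhs_ballP[e /= e0 Pe].
  (* As [d] is at most 1/2, a step up from the lower half of the interval, or down from the upper
     half, stays inside. *)
  pose d := Num.min e 1 / 2.
  have [d0 d1 de] : [/\ 0 < d, 2 * d <= 1 & d < e].
    have m0 : 0 < Num.min e 1 by rewrite lt_min e0 ltr01.
    have [me m1] : Num.min e 1 <= e /\ Num.min e 1 <= 1 by rewrite !ge_min !lexx orbT.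
    by rewrite /d; split; lra.
  have [|] := leP (p i 0) (1 / 2) => pi; [exists d|exists (- d)];
    (apply: Pe; [rewrite /ball /= sub0r ?opprK ?normrN gtr0_norm //
      |by rewrite ?oppr_eq0 gt_eqF
      |by apply/cE; move: up => /andP[? ?]; rewrite /unit_itv; lra]).
apply: lim_near_cst.
  exact: norm_hausdorff.
rewrite /G near_withinE.
near=> h => ch.
have hN0 : h != 0 by near: h; exact: nbhs_dnbhs_neq.
have -> : F p = (p i 0) *: u + v.
  rewrite -Fp //; congr F; apply/matrixP => k j; rewrite mxE ord1.
  by case: eqP => // ->.
rewrite sE Fp; last exact/cE.
by rewrite opprD addrACA subrr addr0 -scalerBl addrK scalerA mulVf // scale1r.
Unshelve. all: by end_near.
Qed.

Lemma set_coord_pt (x y z t : R) :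
  [/\ set_coord (pt x y z) 0 t = pt t y z, set_coord (pt x y z) 1 t = pt x t z
    & set_coord (pt x y z) 2%:R t = pt x y t].
Proof.
by split; apply/matrixP => i j; rewrite !mxE; case: (ord3P i) => -> /=; rewrite ?mxE.
Qed.

(** Iterated differences of the corner values; the constant term is left out because J sees
    derivatives only. *)
Definition trilin_of F : trilin R :=
  let f000 := F (pt 0 0 0) in
  let f100 := F (pt 1 0 0) in let f010 := F (pt 0 1 0) in let f001 := F (pt 0 0 1) in
  let f110 := F (pt 1 1 0) in let f101 := F (pt 1 0 1) in let f011 := F (pt 0 1 1) in
  let f111 := F (pt 1 1 1) in
  Trilin (f100 - f000) (f010 - f000) (f001 - f000)
    (f110 - f100 - f010 + f000) (f101 - f100 - f001 + f000)
    (f011 - f010 - f001 + f000)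
    (f111 - f110 - f101 - f011 + f100 + f010 + f001 - f000).

(** Each partial derivative is a difference of values on opposite faces; interpolating these in the
    other two coordinates reduces everything to the corners. *)
Lemma jac_trilin_of F (x y z : R) : trilinear F ->
  unit_itv x -> unit_itv y -> unit_itv z ->
  jac F (pt x y z) = jacT (trilin_of F) x y z.
Proof.
move=> hF ux uy uz.
have u0 := @unit0 R; have u1 := @unit1 R.
have L i p : cube p -> exists u v, [/\ partial F i p = u, u + v = F (set_coord p i 1),
    v = F (set_coord p i 0) & forall t, unit_itv t -> F (set_coord p i t) = t *: u + v].
  move=> cp; have [u [v uv]] := hF p i cp; exists u, v; split=> //.
  - exact: partialE uv.
  - by rewrite uv ?scale1r.
  - by rewrite uv ?scale0r ?add0r.
have C (a b c : R) : unit_itv a -> unit_itv b -> unit_itv c -> cube (pt a b c).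
  by move=> *; apply/cube_pt.
have Lx (a b c : R) : unit_itv a -> unit_itv b -> unit_itv c ->
    F (pt a b c) = F (pt 0 b c) + a *: (F (pt 1 b c) - F (pt 0 b c)) /\
    partial F 0 (pt a b c) = F (pt 1 b c) - F (pt 0 b c).
  move=> ua ub uc; have [u [v [-> E1 E0 E]]] := L 0 _ (C _ _ _ ua ub uc).
  have [S _ _] := set_coord_pt a b c a; have [S0 _ _] := set_coord_pt a b c 0.
  have [S1 _ _] := set_coord_pt a b c 1.
  by rewrite -S E // -S0 -S1 -E1 -E0 addrK addrC.
have Ly (a b c : R) : unit_itv a -> unit_itv b -> unit_itv c ->
    F (pt a b c) = F (pt a 0 c) + b *: (F (pt a 1 c) - F (pt a 0 c)) /\
    partial F 1 (pt a b c) = F (pt a 1 c) - F (pt a 0 c).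
  move=> ua ub uc; have [u [v [-> E1 E0 E]]] := L 1 _ (C _ _ _ ua ub uc).
  have [_ S _] := set_coord_pt a b c b; have [_ S0 _] := set_coord_pt a b c 0.
  have [_ S1 _] := set_coord_pt a b c 1.
  by rewrite -S E // -S0 -S1 -E1 -E0 addrK addrC.
have Lz (a b c : R) : unit_itv a -> unit_itv b -> unit_itv c ->
    F (pt a b c) = F (pt a b 0) + c *: (F (pt a b 1) - F (pt a b 0)) /\
    partial F 2%:R (pt a b c) = F (pt a b 1) - F (pt a b 0).
  move=> ua ub uc; have [u [v [-> E1 E0 E]]] := L 2%:R _ (C _ _ _ ua ub uc).
  have [_ _ S] := set_coord_pt a b c c; have [_ _ S0] := set_coord_pt a b c 0.
  have [_ _ S1] := set_coord_pt a b c 1.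
  by rewrite -S E // -S0 -S1 -E1 -E0 addrK addrC.
rewrite /jac (@det3E (partial F 0 (pt x y z)) (partial F 1 (pt x y z))
  (partial F 2%:R (pt x y z))); last by move=> k; rewrite !mxE.
rewrite (Lx _ _ _ ux uy uz).2 (Ly _ _ _ ux uy uz).2 (Lz _ _ _ ux uy uz).2.
rewrite /jacT; congr det3; rewrite /dx /dy /dz /=.
- rewrite (Ly _ _ _ u1 uy uz).1 (Ly _ _ _ u0 uy uz).1 (Lz _ _ _ u1 u1 uz).1
    (Lz _ _ _ u1 u0 uz).1 (Lz _ _ _ u0 u1 uz).1 (Lz _ _ _ u0 u0 uz).1.
  apply/matrixP => i j; rewrite !mxE; ring.
- rewrite (Lx _ _ _ ux u1 uz).1 (Lx _ _ _ ux u0 uz).1 (Lz _ _ _ u1 u1 uz).1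
    (Lz _ _ _ u1 u0 uz).1 (Lz _ _ _ u0 u1 uz).1 (Lz _ _ _ u0 u0 uz).1.
  apply/matrixP => i j; rewrite !mxE; ring.
- rewrite (Lx _ _ _ ux uy u1).1 (Lx _ _ _ ux uy u0).1 (Ly _ _ _ u1 uy u1).1
    (Ly _ _ _ u1 uy u0).1 (Ly _ _ _ u0 uy u1).1 (Ly _ _ _ u0 uy u0).1.
  apply/matrixP => i j; rewrite !mxE; ring.
Qed.

(** * The topological boundary of the cube and its faces *)

Lemma closed_cube : closed (@cube R).
Proof.
rewrite (_ : @cube R = \bigcap_(i in setT) ((fun p : 'cV[R]_3 => p i 0) @^-1` `[0, 1])).
  apply: closed_bigI => i _; apply: preimage_closed; last exact: itv_closed.
  by move=> p _; apply: coord_continuous.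
apply/seteqP; split=> p cp i; first by move=> _; rewrite /= in_itv; apply: cp.
by have := cp i I; rewrite /= in_itv.
Qed.

Lemma bd_cube_sub : @bd_cube R `<=` @cube R.
Proof. by rewrite /bd_cube -((closure_id _).1 closed_cube) => p []. Qed.

Lemma bd_cubeP (x y z : R) : bd_cube (pt x y z) <-> on_bd x y z.
Proof.
rewrite /bd_cube -((closure_id _).1 closed_cube); split.
  move=> [/cube_pt[ux uy uz] ni]; rewrite /on_bd ux uy uz /=; apply: contraT.
  rewrite !negb_or => /and5P[x0 x1 y0 y1 /andP[z0 z1]]; exfalso; apply: ni.
  have [xi yi zi] : [/\ 0 < x < 1, 0 < y < 1 & 0 < z < 1].
    move: ux uy uz => /andP[? ?] /andP[? ?] /andP[? ?].
    by rewrite !lt_neqAle ![0 == _]eq_sym x0 x1 y0 y1 z0 z1; split; apply/andP.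
  have int i : 0 < pt x y z i 0 < 1.
    by have [ex ey ez] := ptE x y z; case: (ord3P i) => ->; rewrite ?ex ?ey ?ez.
  have FF : Filter (nbhs (pt x y z)) by apply: nbhs_filter.
  have near_i i : \forall p \near pt x y z, 0 <= (p : 'cV[R]_3) i 0 <= 1.
    have /andP[i0 i1] := int i.
    have ci := @coord_continuous R 3 1 i 0 (pt x y z).
    have n0 : \forall p \near pt x y z, 0 < (p : 'cV[R]_3) i 0 by exact: (cvgr_gt _ ci).
    have n1 : \forall p \near pt x y z, (p : 'cV[R]_3) i 0 < 1 by exact: (cvgr_lt _ ci).
    by near=> p; apply/andP; split; apply/ltW; near: p.
  by apply: (@filter_forall _ _ (fun i => [set p : 'cV[R]_3 | 0 <= p i 0 <= 1]) _ FF).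
move=> /and4P[ux uy uz b]; split; first exact/cube_pt.
have [ex ey ez] := ptE x y z.
have [i i01] : exists i, pt x y z i 0 = 0 \/ pt x y z i 0 = 1.
  move: b; case/or4P => [/eqP h|/eqP h|/eqP h|/or3P[]/eqP h].
  - by exists 0; rewrite ex; left.
  - by exists 0; rewrite ex; right.
  - by exists 1; rewrite ey; left.
  - by exists 1; rewrite ey; right.
  - by exists 2%:R; rewrite ez; left.
  - by exists 2%:R; rewrite ez; right.
move=> /nbhs_ballP[e /= e0 be].
(* All coordinates are shifted by [d], whose sign pushes coordinate [i] out of the unit interval. *)
pose d : R := if pt x y z i 0 == 0 then - (e / 2) else e / 2.
have de : `|d| < e.
  by rewrite /d; case: ifP => _; rewrite ?normrN gtr0_norm ?divr_gt0 //; lra.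
have /be /(_ i) : ball (pt x y z) e (pt x y z + const_mx d).
  split=> // k l; rewrite /ball /= !mxE.
  by rewrite opprD addrA subrr sub0r normrN.
rewrite [(pt x y z + _) i 0]mxE [const_mx d i 0]mxE /d.
case: i01 => ->; rewrite ?eqxx ?oner_eq0; lra.
Unshelve. all: by end_near.
Qed.

Lemma face_ptE (s t : R) (e : bool) : [/\ face_pt 0 e s t = pt e%:R s t,
  face_pt 1 e s t = pt s e%:R t & face_pt 2%:R e s t = pt s t e%:R].
Proof. by []. Qed.

Lemma face_pt_bd i (e : bool) (s t : R) : unit_itv s -> unit_itv t ->
  bd_cube (face_pt i e s t).
Proof.
move=> us ut; have [e0 e1 e2] := face_ptE s t e.
have ue : unit_itv (e%:R : R) by case: e {e0 e1 e2}; rewrite (unit0, unit1).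
have e01 : (e%:R == 0 :> R) || (e%:R == 1 :> R) by case: e {e0 e1 e2 ue}; rewrite eqxx ?orbT.
case: (ord3P i) => ->; rewrite ?e0 ?e1 ?e2; apply/bd_cubeP; rewrite /on_bd us ut ue /=;
  by case/orP: e01 => ->; rewrite ?orbT.
Qed.

Lemma bd_face_pt p : bd_cube p ->
  exists i (e : bool) s t, [/\ unit_itv s, unit_itv t & p = face_pt i e s t].
Proof.
rewrite (pt_coord p); move: (p 0 0) (p 1 0) (p 2%:R 0) => x y z /bd_cubeP.
move=> /and4P[ux uy uz]; case/or4P => [/eqP->|/eqP->|/eqP->|/or3P[]/eqP->].
- by exists 0, false, y, z.
- by exists 0, true, y, z.
- by exists 1, false, x, z.
- by exists 1, true, x, z.
- by exists 2%:R, false, x, y.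
- by exists 2%:R, true, x, y.
Qed.

(** * Candidates and minima on the six faces *)

Lemma serendipity_ext (f g : R -> R -> R) :
  (forall s t, unit_itv s -> unit_itv t -> f s t = g s t) ->
  serendipity g -> serendipity f.
Proof.
move=> fg [k0 [k1 [k2 [k3 [k4 [k5 [k6 [k7 gE]]]]]]]].
by exists k0, k1, k2, k3, k4, k5, k6, k7 => s t us ut; rewrite fg // gE.
Qed.

(** Turning brings the fixed coordinate to the front; on the faces of constant y the others then
    appear as (z, x), hence the swap. *)
Lemma jac_face_form F i (e : bool) : trilinear F ->
  exists a b c, face_form (fun s t => jac F (face_pt i e s t)) a b c.
Proof.
move=> hF; apply: serendipity_face_form.
have ue : unit_itv (e%:R : R) by case: e; rewrite (unit0, unit1).
case: (ord3P i) => ->.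
- apply: serendipity_ext (jacT_serendipity (trilin_of F) e%:R) => s t us ut.
  exact: jac_trilin_of.
- apply: serendipity_ext (serendipity_swap
    (jacT_serendipity (turn (trilin_of F)) e%:R)) => s t us ut.
  by rewrite jacT_turn; apply: jac_trilin_of.
- apply: serendipity_ext (jacT_serendipity (turn (turn (trilin_of F))) e%:R) => s t us ut.
  by rewrite !jacT_turn; apply: jac_trilin_of.
Qed.

Lemma bd_cand_finite F : finite_set (bd_cand F).
Proof.
apply: (@sub_finite_set _ _ (\bigcup_(k in [set: 'I_3 * bool])
  [set face_pt k.1 k.2 q.1 q.2 | q in
    face_cand (fun s t => jac F (face_pt k.1 k.2 s t))])).
  by move=> p [i [e [s [t [fc ->]]]]]; exists (i, e) => //; exists (s, t).
apply: bigcup_finite => [|k _]; first exact: finite_finset.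
by apply: finite_image; apply: face_cand_finite.
Qed.

Lemma bd_cand_sub F : bd_cand F `<=` @bd_cube R.
Proof. by move=> p [i [e [s [t [/face_cand_unit[us ut] ->]]]]]; apply: face_pt_bd. Qed.

Lemma bd_cand_min F : trilinear F ->
  exists2 q, bd_cand F q & forall p, bd_cube p -> jac F q <= jac F p.
Proof.
move=> hF.
have H (k : 'I_3 * bool) : exists q : R * R,
    face_cand (fun s t => jac F (face_pt k.1 k.2 s t)) q /\
    unit_square_min (fun s t => jac F (face_pt k.1 k.2 s t)) q.1 q.2.
  have [a [b [c ff]]] := jac_face_form k.1 k.2 hF.
  by have [s [t [fc m]]] := face_min ff; exists (s, t).
have [q qP] := choice H.
pose v k := face_pt k.1 k.2 (q k).1 (q k).2.
(* The best of the six face minima; [(0, true)] only witnesses that there is a face. *)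
case: (@Order.TotalTheory.arg_minP _ _ _ (0, true) xpredT (fun k => jac F (v k)) isT) => k _ kmin.
exists (v k).
  exists k.1, k.2, (q k).1, (q k).2; split=> //.
  by rewrite -surjective_pairing; apply: (qP k).1.
move=> p /bd_face_pt[i [e [s [t [us ut ->]]]]].
apply: le_trans (kmin (i, e) isT) _.
by have [_ [_ _ m]] := qP (i, e); apply: m.
Qed.

End Hexahedra.

Theorem mainTheorem4 (R : realType) (F : 'cV[R]_3 -> 'cV[R]_3)
    (hF : trilinear F) :
  [/\ finite_set (bd_cand F) /\ bd_cand F `<=` @bd_cube R,
      exists m : R,
        is_min (jac F) (bd_cand F) m /\ is_min (jac F) (@bd_cube R) m,
      valid_hex F <-> (forall p, bd_cand F p -> 0 < jac F p) &
      forall m : R, is_min (jac F) (bd_cand F) m -> 0 < m ->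
        is_min (jac F) (@cube R) m].
Proof.
have sub := @bd_cand_sub R F.
have bdc := @bd_cube_sub R.
have [q qc qmin] := bd_cand_min hF.
(* [q] minimizes J over the boundary, so positivity there is decided at this one candidate. *)
have bdT : 0 < jac F q -> forall x y z, on_bd x y z -> 0 < jacT (trilin_of F) x y z.
  move=> q0 x y z b; have /and4P[ux uy uz _] := b.
  rewrite -jac_trilin_of //; apply: lt_le_trans q0 (qmin _ _).
  exact/bd_cubeP.
split.
- by split; [exact: bd_cand_finite|exact: sub].
- exists (jac F q); split; split.
  + by exists q.
  + by move=> _ [p pc <-]; apply/qmin/sub.
  + by exists q => //; apply: sub.
  + by move=> _ [p pc <-]; apply: qmin.
- split=> [val p /sub/bdc|pos p]; first exact: val.
  rewrite (pt_coord p) => /cube_pt[ux uy uz]; rewrite jac_trilin_of //.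
  by apply: jacT_pos => //; apply: bdT; apply: pos.
- move=> m [[p pc <-] pmin] p0; split; first by exists p => //; apply/bdc/sub.
  have pq : jac F p <= jac F q by apply: pmin; exists q.
  have [x [y [z [b min]]]] := jacT_min_bd (bdT (lt_le_trans p0 pq)).
  move=> _ [r rc <-]; move: rc; rewrite (pt_coord r) => /cube_pt[ux uy uz].
  rewrite jac_trilin_of //; apply: le_trans (min _ _ _ ux uy uz).
  apply: le_trans pq _; have /and4P[? ? ? _] := b.
  by rewrite -jac_trilin_of //; apply/qmin/bd_cubeP.
Qed.
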